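(* Let $\mathcal{K}_0$ be the family of closed convex subsets of $\mathbb{R}^n$ containing $0$, and let $\mathcal{F}$ be the family of all flowers in $\mathbb{R}^n$. (1) Let $f:\mathcal{F}\to\mathcal{K}_0$ be a one-to-one and onto map such that $f$ and $f^{-1}$ preserve the order of inclusion (i.e. $F_1\subseteq F_2$ if and only if $f(F_1)\subseteq f(F_2)$). Then there exists an invertible linear map $u:\mathbb{R}^n\to\mathbb{R}^n$ such that $f(F)=u\left(F^{-\clubsuit}\right)$, where $F^{-\clubsuit}$ is the core of $F$. (2) Let $g:\mathcal{F}\to\mathcal{K}_0$ be a one-to-one and onto map such that $g$ and $g^{-1}$ reverse the order of inclusion (i.e. $F_1\subseteq F_2$ if and only if $g(F_1)\supseteq g(F_2)$). Then there exists an invertible linear map $u:\mathbb{R}^n\to\mathbb{R}^n$ such that $g(F)=u\left(\mathrm{co}\varphi(F)\right)$, where $\mathrm{co}\varphi$ is the co-image under spherical inversion.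
   Context: For $x\in\mathbb{R}^n$ let $B_x$ be the Euclidean ball with center $x/2$ and radius $|x|/2$, i.e. the ball with diameter $[0,x]$. A star body is a set $A\subseteq\mathbb{R}^n$ such that $\lambda A\subseteq A$ for all $0\le\lambda\le1$; its radial function is $r_A(\theta)=\sup\{t\ge 0: t\theta\in A\}$ for $\theta\in S^{n-1}$. Closures of star bodies are taken radially (along each ray from the origin), and star bodies, in particular flowers, are taken to be radially closed. A flower is any set of the form $F=\bigcup_{\alpha}B_\alpha$ for a collection of Euclidean balls $\{B_\alpha\}$ each of which contains $0$. Equivalently, a flower is any set of the form $F=\bigcup_{\alpha}B_{x_\alpha}$ for a set $\{x_\alpha\}\subseteq\mathbb{R}^n$. The core of a flower $F$ is $F^{-\clubsuit}=\{x\in\mathbb{R}^n: B_x\subseteq F\}$, which belongs to $\mathcal{K}_0$. The map $F\mapsto F^{-\clubsuit}$ is a bijection from $\mathcal{F}$ onto $\mathcal{K}_0$. Spherical inversion is $\phi(x)=x/|x|^2$ for $x\ne0$. For a star body $A$, the co-image of $\phi$ is $\mathrm{co}\varphi(A)=\overline{\{x: x\notin\phi(A)\}}$, with the closure taken radially. For a flower $F$, $\mathrm{co}\varphi(F)\in\mathcal{K}_0$.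
   Formalization: The formal statement assumes n ≥ 2: for n = 1 the claim fails, since flowers and K_0 are both the closed intervals containing 0, the core is the identity, and [-a,b] ↦ [-a³,b³] is a non-linear order isomorphism. *)

(* Defs.v *)
From HB Require Import structures.
From mathcomp Require Import all_boot all_order all_algebra.
From mathcomp Require Import all_classical all_reals all_analysis.

Set Implicit Arguments.
Unset Strict Implicit.
Unset Printing Implicit Defensive.

Import Order.TTheory GRing.Theory Num.Theory.
Import numFieldTopology.Exports.

Local Open Scope classical_set_scope.
Local Open Scope ring_scope.

Section Flowers.
Variables (R : realType) (n : nat).
Local Notation V := 'rV[R]_n.

(* The library norm on ['rV[R]_n] is the sup norm, hence this definition.
   It induces the same topology, so [closed] below needs no adaptation. *)
Definition enorm (x : V) : R := Num.sqrt (\sum_i x ord0 i ^+ 2).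

(* Radius 0 is allowed by the uses below: the ball with diameter [0, 0]
   is the singleton {0}. *)
Definition eball (c : V) (r : R) : set V := [set y | enorm (y - c) <= r].

Definition diam_ball (x : V) : set V := eball (2^-1 *: x) (enorm x / 2).

Definition radial_closure (A : set V) : set V :=
  [set x | exists (theta : V) (t : R), [/\ enorm theta = 1,
    closure [set s : R | 0 <= s /\ A (s *: theta)] t & x = t *: theta]].

(* [C] is a set of pairs (center, radius).  It must be nonempty, as the empty
   union is not a star body with core in [K0].  The radial closure is the
   convention that flowers are radially closed; for infinite families the
   union itself may fail to be: for
   K = {(a, b) | 0 <= a, 0 <= b <= 1 - 1 / (1 + a)} in the plane, the union of
   the balls with diameters [0, x], x in K, contains t * (0, 1) for
   0 <= t < 1 but not for t = 1. *)
Definition flower : set (set V) :=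
  [set F | exists C : set (V * R),
    [/\ C !=set0,
        forall p, C p -> 0 <= p.2 /\ eball p.1 p.2 0
      & F = radial_closure (\bigcup_(p in C) eball p.1 p.2)]].

Definition K0 : set (set V) :=
  [set K | [/\ closed K, convex_set (K : set (convex_lmodType V)) & K 0]].

Definition core (F : set V) : set V := [set x | diam_ball x `<=` F].

Definition inversion (x : V) : V := enorm x ^- 2 *: x.

(* The origin is removed since the formula above gives [inversion 0 = 0],
   whereas the spherical inversion is undefined at 0. *)
Definition co_image (A : set V) : set V :=
  radial_closure (~` (inversion @` (A `\ 0))).

End Flowers.

Arguments flower {R n}.
Arguments K0 {R n}.

(* Main.v *)
Require Import Defs.
From HB Require Import structures.
From mathcomp Require Import all_boot all_order all_algebra.
From mathcomp Require Import all_classical all_reals all_analysis.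
From mathcomp Require Import ring lra.

Import Order.TTheory GRing.Theory Num.Theory.
Import numFieldTopology.Exports.

Local Open Scope classical_set_scope.
Local Open Scope ring_scope.

(** Every ball containing 0 is a union of balls with diameters [[0, x]], so a
    flower is, up to radial closure, the union of the balls with diameters
    [[0, x]] for [x] in some set [X]; its core is then the bipolar of [X] and
    its co-image the polar of [X].  By the bipolar theorem the core is an order
    isomorphism from flowers to [K0], with [co_image F = polar (core F)], and
    part (2) reduces to part (1) by composing with polarity.

    It remains to describe an order isomorphism [h] of [K0].  The segments
    [[0, x]] are recognizable in the order, hence [h] sends [[0, x]] to
    [[0, T x]] for a bijection [T], and [h K = T @` K].  As triangles
    [conv {0, x, y}] are the least elements of [K0] containing two points, [T]
    preserves them, and therefore rays from 0, lines through 0 and segments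
    whose ends are independent.  An argument with parallels makes [T]
    additive, and the monotonicity on rays makes it homogeneous. *)

(** * Polarity in Euclidean space *)

Section InnerProduct.
Set Implicit Arguments.
Unset Strict Implicit.
Unset Printing Implicit Defensive.
Variables (R : realType) (n : nat).
Local Notation V := 'rV[R]_n.
Implicit Types (x y z : V) (X Y K : set V).

Definition dot x y : R := \sum_i x ord0 i * y ord0 i.

Lemma dotC x y : dot x y = dot y x.
Proof. by apply: eq_bigr => i _; rewrite mulrC. Qed.

Lemma dotDl x y z : dot (x + y) z = dot x z + dot y z.
Proof. by rewrite -big_split; apply: eq_bigr => i _; rewrite mxE mulrDl. Qed.

Lemma dotDr x y z : dot z (x + y) = dot z x + dot z y.
Proof. by rewrite dotC dotDl !(dotC z). Qed.

Lemma dotZl a x y : dot (a *: x) y = a * dot x y.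
Proof. by rewrite mulr_sumr; apply: eq_bigr => i _; rewrite mxE mulrA. Qed.

Lemma dotZr a x y : dot x (a *: y) = a * dot x y.
Proof. by rewrite dotC dotZl dotC. Qed.

Lemma dotNl x y : dot (- x) y = - dot x y.
Proof. by rewrite -scaleN1r dotZl mulN1r. Qed.

Lemma dotNr x y : dot x (- y) = - dot x y.
Proof. by rewrite dotC dotNl dotC. Qed.

Lemma dot0l x : dot 0 x = 0.
Proof. by rewrite -(scale0r 0) dotZl mul0r. Qed.

Lemma dot0r x : dot x 0 = 0.
Proof. by rewrite dotC dot0l. Qed.

Definition dotE := (dotDl, dotDr, dotNl, dotNr, dotZl, dotZr, dot0l, dot0r).

Lemma dot_ge0 x : 0 <= dot x x.
Proof. by apply: sumr_ge0 => i _; rewrite -expr2 sqr_ge0. Qed.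

Lemma dot_eq0 x : (dot x x == 0) = (x == 0).
Proof.
apply/idP/eqP => [|->]; last by rewrite dot0l.
rewrite psumr_eq0 => [/allP x0|i _]; last by rewrite -expr2 sqr_ge0.
apply/rowP => i; rewrite mxE; apply/eqP.
by have := x0 i (mem_index_enum _); rewrite -expr2 sqrf_eq0.
Qed.

Lemma dot_gt0 x : x != 0 -> 0 < dot x x.
Proof. by rewrite lt_def dot_ge0 andbT dot_eq0. Qed.

Lemma dot_mulmx (M : 'M[R]_n) x y : dot (x *m M) y = dot x (y *m M^T).
Proof.
have dotmx u v : dot u v = (u *m v^T) ord0 ord0.
  by rewrite mxE; apply: eq_bigr => i _; rewrite mxE.
by rewrite !dotmx trmx_mul trmxK mulmxA.
Qed.

Lemma dot_continuous x : continuous (dot x : V -> R).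
Proof.
apply: continuous_big => [|i _ y]; first exact: add_continuous.
have c := @coord_continuous R 1 n ord0 i y.
exact: (@cvgM _ _ _ _ _ _ _ _ (cvg_cst (x ord0 i)) c).
Qed.

Lemma dot_sqr_continuous x : continuous (fun y : V => dot (y - x) (y - x)).
Proof.
apply: continuous_big => [|i _ y]; first exact: add_continuous.
have c : {for y, continuous (fun z : V => (z - x) ord0 i)}.
  rewrite (_ : (fun _ => _) = (fun z : V => z ord0 i - x ord0 i)).
    have c := @coord_continuous R 1 n ord0 i y.
    exact: (@cvgB _ _ _ _ _ _ _ _ _ c (cvg_cst (x ord0 i))).
  by apply/funext => z; rewrite !mxE.
exact: (@cvgM _ _ _ _ _ _ _ _ c c).
Qed.

Lemma enormE x : enorm x = Num.sqrt (dot x x).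
Proof. by congr Num.sqrt; apply: eq_bigr => i _; rewrite expr2. Qed.

Lemma enorm_ge0 x : 0 <= enorm x.
Proof. by rewrite enormE sqrtr_ge0. Qed.

Lemma enorm_sqr x : enorm x ^+ 2 = dot x x.
Proof. by rewrite enormE sqr_sqrtr ?dot_ge0. Qed.

Lemma enorm_le x (r : R) : 0 <= r -> (enorm x <= r) = (dot x x <= r ^+ 2).
Proof.
by move=> r0; rewrite -enorm_sqr ler_pXn2r ?nnegrE ?enorm_ge0.
Qed.

(** Thales' condition: the angle at [y] is at least a right one. Later arguments on these balls use
    this form. *)
Lemma diam_ballE x y : diam_ball x y <-> dot y y <= dot x y.
Proof.
rewrite /diam_ball /eball /= enorm_le ?divr_ge0 ?enorm_ge0//.
rewrite expr_div_n enorm_sqr !dotE (dotC y x).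
by split; lra.
Qed.

Lemma convexP K : convex_set (K : set (convex_lmodType V)) <->
  forall x y (a : R), K x -> K y -> 0 <= a -> a <= 1 -> K (a *: x + (1 - a) *: y).
Proof.
split=> [cK x y a Kx Ky a0 a1|cK x y a /set_mem Kx /set_mem Ky].
  have a01 : 0 <= a <= 1 by rewrite a0 a1.
  have ab : Itv.spec (@Itv.num_sem R) (Itv.Real `[0%Z, 1%Z]) a.
    by rewrite /= /Itv.num_sem /= in_itv /= num_real a0 a1.
  have := cK x y (Itv.mk ab) (mem_set Kx) (mem_set Ky).
  by move=> /set_mem.
apply/mem_set; exact: (cK x y (a%:num) Kx Ky (ge0 a) (le1 a)).
Qed.

Definition polar X : set V := [set y | forall x, X x -> dot x y <= 1].

Lemma polar_K0 X : K0 (polar X).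
Proof.
split.
- rewrite [polar X](_ : _ = \bigcap_(x in X) (dot x @^-1` [set r : R | r <= 1])).
    apply: closed_bigI => x _; apply: preimage_closed; last exact: closed_le.
    by move=> y _; exact: dot_continuous.
  by apply/seteqP; split.
- apply/convexP => x y a Px Py a0 a1 z Xz.
  have := Px _ Xz; have := Py _ Xz; rewrite !dotE; nra.
- by move=> x _; rewrite dot0r.
Qed.

Lemma polarS X Y : X `<=` Y -> polar Y `<=` polar X.
Proof. by move=> XY y Yy x /XY; exact: Yy. Qed.

Lemma sub_bipolar X : X `<=` polar (polar X).
Proof. by move=> x Xx y /(_ _ Xx); rewrite dotC. Qed.

Lemma bounded_dotball x (r : R) : bounded_set [set y : V | dot (y - x) (y - x) <= r].
Proof.
exists (`|x| + r + 1); split; first by rewrite num_real.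
move=> M /ltW hM y /= hy; apply: le_trans hM.
have -> : y = (y - x) + x by rewrite subrK.
rewrite (le_trans (ler_normD _ _))// [_ + `|x|]addrC -addrA lerD2l.
rewrite [leLHS]/Num.norm /= mx_normrE; apply/bigmax_leP; split; first by have := dot_ge0 (y - x); lra.
move=> [i j] _ /=; rewrite ord1.
have : (y - x) ord0 j ^+ 2 <= r.
  apply: le_trans hy; rewrite /dot (bigD1 j)//= -expr2 lerDl.
  by apply: sumr_ge0 => k _; rewrite -expr2 sqr_ge0.
set t := (y - x) _ _; rewrite ler_norml => h.
apply/andP; split; nra.
Qed.

Lemma nearest_point K x : closed K -> K !=set0 ->
  exists2 p, K p & forall y, K y -> dot (p - x) (p - x) <= dot (y - x) (y - x).
Proof.
move=> cK [k Kk]; pose f (y : V) := dot (y - x) (y - x).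
have cf : continuous f by exact: dot_sqr_continuous.
pose A := K `&` (f @^-1` [set r : R | r <= f k]).
have cA : compact A.
  apply: bounded_closed_compact.
    have [M [Mr bM]] := bounded_dotball x (f k).
    by exists M; split=> // r /bM br y [_ /br].
  apply: closedI => //; apply: preimage_closed; last exact: closed_le.
  by move=> y _; exact: cf.
have A0 : A !=set0 by exists k; split=> //=; rewrite lexx.
have cfA : {within A, continuous f} by apply: continuous_subspaceT.
have [p /set_mem[Kp _] pmin] := compact_EVT_min A0 cA cfA.
exists p => // y Ky; have [yk|ky] := leP (f y) (f k).
  by apply: pmin; apply/mem_set; split.
apply: le_trans (ltW ky); apply: pmin; apply/mem_set; split=> //=.
Qed.

(* The hyperplane through the projection of a point separates it from [K]. *)
Lemma bipolar K : K0 K -> polar (polar K) = K.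
Proof.
move=> [cK /convexP vK zK]; apply/seteqP; split; last exact: sub_bipolar.
move=> x Px; apply: contrapT => nKx.
have [|p Kp pmin] := nearest_point x cK; first by exists 0.
have [w wE] : exists w : V, w = x - p by exists (x - p).
have w0 : 0 < dot w w.
  apply: dot_gt0; rewrite wE subr_eq0; apply/eqP => xp.
  by apply: nKx; rewrite xp.
have Kw y : K y -> dot y w <= dot p w.
  move=> Ky; rewrite leNgt; apply/negP => yw.
  have [d dE] : exists d : V, d = y - p by exists (y - p).
  pose c := dot d w.
  have c0 : 0 < c by rewrite /c dE dotDl dotNl subr_gt0.
  (* Compares [p] with the points of [[p, y]], which convexity keeps in [K]; a small [t] is then
     contradictory. *)
  have quad (t : R) : 0 <= t -> t <= 1 -> 2 * c <= t * dot d d \/ t = 0.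
    move=> t0 t1; have [->|tn0] := eqVneq t 0; [by right|left].
    have tp : 0 < t by rewrite lt_def tn0.
    have := pmin _ (vK y p t Ky Kp t0 t1).
    have -> : t *: y + (1 - t) *: p - x = t *: d - w.
      by rewrite dE wE; apply/rowP => i; rewrite !mxE; ring.
    have -> : p - x = - w by rewrite wE opprB.
    rewrite !dotE (dotC w d) -/c => h.
    have : 0 <= t * (t * dot d d - 2 * c) by lra.
    by rewrite pmulr_rge0//; lra.
  have d0 := dot_ge0 d.
  have tt : 0 < c / (c + dot d d) by apply: divr_gt0 => //; lra.
  have t1 : c / (c + dot d d) <= 1 by rewrite ler_pdivrMr; lra.
  have [|h] := quad _ (ltW tt) t1; last by rewrite h ltxx in tt.
  apply/negP; rewrite -ltNge mulrAC ltr_pdivrMr; nra.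
have pw0 : 0 <= dot p w by rewrite -(dot0l w); apply: Kw.
have xw : dot x w = dot p w + dot w w by rewrite -dotDl; congr dot; rewrite wE addrC subrK.
(* Midway between [dot p w], the maximum of [dot _ w] on [K], and its value at [x]; so [s^-1 *: w]
   is in the polar and excludes [x]. *)
pose s := dot p w + dot w w / 2.
have s0 : 0 < s by rewrite /s; lra.
have : polar K (s^-1 *: w).
  move=> y /Kw; rewrite dotZr mulrC ler_pdivrMr// /s; lra.
by move=> /Px; rewrite dotC dotZr mulrC ler_pdivrMr// xw /s; lra.
Qed.

(** By adjunction; the inverse transpose becomes the linear map of the order-reversing case. *)
Lemma polar_mulmx (M : 'M[R]_n) X : M \in unitmx ->
  polar ((fun x => x *m M) @` X) = (fun x => x *m invmx M^T) @` polar X.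
Proof.
move=> uM; have uMt : M^T \in unitmx by rewrite unitmx_tr.
apply/seteqP; split=> [y Py|_ [y Py <-] _ [x Xx <-]].
  exists (y *m M^T); last by rewrite mulmxK.
  by move=> x Xx; rewrite -dot_mulmx; apply: Py; exists x.
by rewrite dot_mulmx mulmxKV//; apply: Py.
Qed.

End InnerProduct.

(** * Flowers, cores and co-images *)

Section Flowers.
Set Implicit Arguments.
Unset Strict Implicit.
Unset Printing Implicit Defensive.
Variables (R : realType) (n : nat).
Local Notation V := 'rV[R]_n.
Implicit Types (c x y z : V) (A X Y K F : set V).

Lemma closure_realP (S : set R) t :
  closure S t <-> forall e, 0 < e -> exists2 s, S s & `|t - s| < e.
Proof.
split=> [St e e0|St B /nbhs_ballP[e e0 eB]].
  by have [s [Ss ts]] := St _ (nbhsx_ballx t e e0); exists s.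
by have [s Ss ts] := St _ e0; exists s; split=> //; apply: eB.
Qed.

Lemma exists_unit : (0 < n)%N -> exists theta : V, enorm theta = 1.
Proof.
case: n => // m _; exists (delta_mx ord0 ord0).
rewrite enormE /dot (bigD1 ord0)//= big1 => [|i /negPf i0].
  by rewrite !mxE eqxx mulr1 addr0 sqrtr1.
by rewrite !mxE i0 andbF mul0r.
Qed.

(** Each ray meets [A] in an interval starting at 0, so a limit along the ray has all its proper
    contractions in [A]. *)
Lemma radial_closure_star A : (0 < n)%N -> A 0 ->
  (forall x a, A x -> 0 <= a -> a <= 1 -> A (a *: x)) ->
  radial_closure A = [set y | forall a, 0 <= a -> a < 1 -> A (a *: y)].
Proof.
move=> n0 A0 sA; apply/seteqP; split=> [_ [theta [t [th1 St ->]]] a a0 a1|y Ay].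
  have [->|tn0] := eqVneq t 0; first by rewrite scale0r scaler0.
  move/closure_realP in St.
  have t0 : 0 < t.
    rewrite lt_def tn0 leNgt; apply/negP => t0.
    have [|s [s0 _]] := St (- t); first by rewrite oppr_gt0.
    by rewrite ltr_norml; lra.
  have [|s [s0 As]] := St (t * (1 - a)); first by rewrite mulr_gt0// subr_gt0.
  rewrite ltr_norml => /andP[_ st].
  have at0 : 0 <= a * t by apply: mulr_ge0 => //; exact: ltW.
  have sp : 0 < s by lra.
  have -> : a *: (t *: theta) = (a * t / s) *: (s *: theta).
    by rewrite !scalerA divfK// gt_eqF.
  by apply: sA => //; [apply: divr_ge0 | rewrite ler_pdivrMr//; lra].
have [y0|yn0] := eqVneq y 0.
  have [theta th1] := exists_unit n0.
  exists theta, 0; split; rewrite ?scale0r//.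
  by apply: subset_closure; split; rewrite ?scale0r.
have t0 : 0 < enorm y by rewrite enormE sqrtr_gt0 dot_gt0.
exists ((enorm y)^-1 *: y), (enorm y); split; last first.
- by rewrite scalerA divff ?scale1r// gt_eqF.
- apply/closure_realP => e e0.
  (* Makes the gap [d * enorm y] at most [e / 2] while keeping [1 - d] nonnegative. *)
  pose d := Num.min 1 (e / (2 * enorm y)).
  have d0 : 0 < d by rewrite lt_min ltr01 divr_gt0// mulr_gt0.
  have d1 : d <= 1 by rewrite ge_min lexx.
  have de : d * (2 * enorm y) <= e.
    by rewrite -ler_pdivlMr ?mulr_gt0// ge_min lexx orbT.
  exists ((1 - d) * enorm y).
    split; first by rewrite mulr_ge0 ?subr_ge0// ltW.
    rewrite scalerA mulfK ?gt_eqF//; apply: Ay; lra.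
  rewrite ger0_norm; nra.
- by rewrite enormE !dotE -enorm_sqr expr2 mulKf ?gt_eqF// mulVf ?gt_eqF// sqrtr1.
Qed.

(* The radial function of this set is the positive part of the support function
   of [X]; the factor [a] accounts for a supremum that is not attained. *)
Definition pedal X : set V := [set y | forall a : R, 0 < a -> a < 1 ->
  exists2 x, X x & a * dot y y <= dot x y].

Lemma radial_closure_diam_balls X : (0 < n)%N -> X !=set0 ->
  radial_closure (\bigcup_(x in X) diam_ball x) = pedal X.
Proof.
move=> n0 [x0 Xx0]; rewrite radial_closure_star//.
- apply/seteqP; split=> y Py a a0 a1.
    have [x Xx /diam_ballE] := Py a (ltW a0) a1.
    rewrite !dotE ler_pM2l// => axy; by exists x.
  have [->|an0] := eqVneq a 0.
    by exists x0 => //; apply/diam_ballE; rewrite !dotE; lra.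
  have ap : 0 < a by rewrite lt_def an0.
  have [x Xx axy] := Py a ap a1; exists x => //; apply/diam_ballE.
  by rewrite !dotE ler_pM2l.
- by exists x0 => //; apply/diam_ballE; rewrite !dotE.
- move=> y a [x Xx /diam_ballE xy] a0 a1; exists x => //; apply/diam_ballE.
  rewrite !dotE ler_wpM2l//; apply: le_trans xy; have := dot_ge0 y; nra.
Qed.

(* The witness is the ball tangent internally to [eball c r] at [y], when [y]
   lies on its boundary: its center is the point of [[c, y]] equidistant from
   0 and [y]. *)
Lemma eball_diam_ball c (r : R) y : 0 <= r -> eball c r 0 -> eball c r y ->
  exists2 x, diam_ball x y & diam_ball x `<=` eball c r.
Proof.
move=> r0; rewrite /eball /= !enorm_le// sub0r !dotE (dotC y c) => cr yr.
(* In the first case [|y - c| < |c|]: the ball centered at [c] through 0 contains [y], and lies in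
   [eball c r] since 0 does. *)
have [yc|yc] := ltP (dot y y) (2 * dot c y).
  exists (2 *: c); first by apply/diam_ballE; rewrite !dotE; lra.
  move=> z /diam_ballE; rewrite /= enorm_le// !dotE (dotC z c); lra.
have [->|yn0] := eqVneq y 0.
  exists 0; first by apply/diam_ballE; rewrite !dotE.
  move=> z /diam_ballE; rewrite dot0l => zz.
  have /eqP : dot z z == 0 by rewrite eq_le zz dot_ge0.
  move/eqP; rewrite dot_eq0 => /eqP ->; rewrite /= enorm_le// !dotE; lra.
have yy := dot_gt0 yn0.
(* Solves [|y + s (c - y)| = s |c - y|], the equidistance from 0 and [y]. *)
pose s := dot y y / (2 * (dot y y - dot c y)).
have D0 : 0 < 2 * (dot y y - dot c y) by lra.
have s0 : 0 < s by apply: divr_gt0.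
have s1 : s <= 1 by rewrite ler_pdivrMr; lra.
have sD : s * (2 * (dot y y - dot c y)) = dot y y by rewrite divfK// gt_eqF.
clearbody s.
exists (2 *: (y + s *: (c - y))); first by apply/diam_ballE; rewrite !dotE; lra.
move=> z /diam_ballE; rewrite /= enorm_le// !dotE (dotC z c) => zz.
have := dot_ge0 (z - y); rewrite !dotE (dotC z y) => zy.
(* Sum of [zz] and [1 - s] times [zy], as [sD] makes the right side [(1 - s) * dot y y]. *)
suff : s * (dot z z - 2 * dot c z) <= s * (dot y y - 2 * dot c y).
  by rewrite ler_pM2l//; lra.
nra.
Qed.

(** By [eball_diam_ball], a ball containing 0 is the union of the diametral balls inside it, so both
    presentations have the same union before radial closure. *)
Lemma flowerP F : (0 < n)%N ->
  flower F <-> exists2 X, X !=set0 & F = pedal X.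
Proof.
move=> n0; split=> [[C [[p Cp] C0 ->]]|[X [x Xx] ->]].
  pose X := [set x : V | exists2 p, C p & diam_ball x `<=` eball p.1 p.2].
  have X0 : X !=set0.
    have [r0 p0] := C0 p Cp; have [x _ xp] := eball_diam_ball r0 p0 p0.
    by exists x, p.
  exists X => //; rewrite -radial_closure_diam_balls//; congr radial_closure.
  apply/seteqP; split=> [y [q Cq qy]|y [x [q Cq xq] xy]].
    have [r0 q0] := C0 q Cq; have [x xy xq] := eball_diam_ball r0 q0 qy.
    by exists x => //; exists q.
  by exists q => //; apply: xq.
exists [set (2^-1 *: x, enorm x / 2) | x in X]; split.
- by exists (2^-1 *: x, enorm x / 2), x.
- move=> _ [z Xz <-] /=; rewrite divr_ge0 ?enorm_ge0//; split=> //.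
  by apply/(diam_ballE z 0); rewrite !dotE.
- rewrite -radial_closure_diam_balls; [|by []|by exists x].
  congr radial_closure; apply/seteqP; split=> [y [z Xz zy]|y [_ [z Xz <-] zy]].
    by exists (2^-1 *: z, enorm z / 2) => //; exists z.
  by exists z.
Qed.

(** Both sides say that, in every direction, the positive part of the support function of [x] is at
    most that of [X]. *)
Lemma core_pedal X : X !=set0 -> core (pedal X) = polar (polar X).
Proof.
move=> [x0 Xx0]; apply/seteqP; split=> [x xX w Xw|x Xx y /diam_ballE xy a a0 a1].
  rewrite dotC leNgt; apply/negP => xw.
  have wn0 : w != 0 by apply: contraTneq xw => ->; rewrite dot0r ltr10.
  have ww := dot_gt0 wn0.
  (* [q *: w] is the foot of the perpendicular from [x], the farthest point of [diam_ball x] on the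
     ray of [w]. *)
  pose q := dot x w / dot w w.
  have q0 : 0 < q by apply: divr_gt0; lra.
  have qw : q * dot w w = dot x w by rewrite divfK// gt_eqF.
  have /(xX _) qX : diam_ball x (q *: w) by apply/diam_ballE; rewrite !dotE qw.
  have xV : dot x w * (dot x w)^-1 = 1 by rewrite divff// gt_eqF//; lra.
  have xVp : 0 < (dot x w)^-1 by rewrite invr_gt0; lra.
  have xV1 : (dot x w)^-1 < 1 by rewrite invf_lt1//; lra.
  (* A factor strictly between [(dot x w)^-1] and 1, forcing [dot z w > 1] for some [z] in [X]. *)
  have [||z Xz] := qX ((1 + (dot x w)^-1) / 2); [lra|lra|].
  rewrite !dotE qw mulrCA ler_pM2l//; have := Xw z Xz; nra.
have [y0|yn0] := leP (dot y y) 0.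
  have /eqP : dot y y == 0 by rewrite eq_le y0 dot_ge0.
  move/eqP; rewrite dot_eq0 => /eqP ye.
  by exists x0; rewrite // ye !dotE mulr0.
apply: contrapT => nX.
have ayy : 0 < a * dot y y by rewrite mulr_gt0.
(* If no point of [X] reaches [a * dot y y] in direction [y], this multiple of [y] is in the polar,
   whence [dot x y <= a * dot y y]. *)
have /Xx : polar X ((a * dot y y)^-1 *: y).
  move=> z Xz; rewrite dotZr mulrC ler_pdivrMr// mul1r leNgt.
  by apply/negP => /ltW h; apply: nX; exists z.
rewrite dotC dotZr mulrC ler_pdivrMr//; nra.
Qed.

(** Makes a flower determined by its core. *)
Lemma pedalS X Y : X !=set0 -> core (pedal X) `<=` core (pedal Y) -> pedal X `<=` pedal Y.
Proof.
move=> X0; rewrite core_pedal// => XY y Xy a a0 a1.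
(* One factor [sqrt a] finds [x] in [X] whose ball contains [b *: y]; the other is spent in
   [pedal Y] at that point. *)
have b0 : 0 < Num.sqrt a by rewrite sqrtr_gt0.
have b1 : Num.sqrt a < 1 by rewrite -sqrtr1 ltr_sqrt.
have ab : a = Num.sqrt a * Num.sqrt a by rewrite -expr2 sqr_sqrtr// ltW.
set b := Num.sqrt a in b0 b1 ab.
have [x /sub_bipolar/XY xY xy] := Xy b b0 b1.
have /xY/(_ b b0 b1)[z Yz] : diam_ball x (b *: y).
  by apply/diam_ballE; rewrite !dotE ler_pM2l.
by rewrite !dotE [b * (b * _)]mulrCA ler_pM2l// => byz; exists z; rewrite // ab; lra.
Qed.

Lemma inversionK x : x != 0 -> inversion (inversion x) = x.
Proof.
move=> /dot_gt0 xx; rewrite /inversion !enorm_sqr !dotE mulVf ?gt_eqF//.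
by rewrite mulr1 invrK scalerA divff ?scale1r ?gt_eqF.
Qed.

(** For [w = inversion z], [z] is in the pedal when [dot _ w] has supremum at least 1 on [X]. The
    complement [W] is thus a strict polar, and radial closure relaxes its bound to [<= 1]. *)
Lemma co_image_pedal X : (0 < n)%N -> X !=set0 ->
  co_image (pedal X) = polar X.
Proof.
move=> n0 [x0 Xx0]; pose W : set V := [set w | exists2 a : R,
  0 < a < 1 & forall x, X x -> dot x w < a].
have -> : co_image (pedal X) = radial_closure W.
  congr radial_closure; apply/seteqP; split=> w.
    move=> nw; apply: contrapT => nW; apply: nw.
    have wn0 : w != 0.
      apply/eqP => w0; apply: nW; exists 2^-1; first by lra.
      by move=> x _; rewrite w0 dot0r; lra.
    have ww := dot_gt0 wn0.
    exists (inversion w); last exact: inversionK.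
    split=> [a a0 a1|]; last first.
      by apply/eqP; rewrite scaler_eq0 negb_or invr_eq0 enorm_sqr gt_eqF.
    apply: contrapT => nX; apply: nW; exists a; first by rewrite a0.
    move=> x Xx; rewrite ltNge; apply/negP => ax; apply: nX; exists x => //.
    rewrite /inversion enorm_sqr !dotE mulVf ?gt_eqF// mulr1 mulrC.
    by rewrite ler_pM2l ?invr_gt0.
  move=> [a /andP[a0 a1] aX] [z [Xz zn0] zw].
  have zz : 0 < dot z z by apply: dot_gt0; apply/eqP.
  have [x Xx] := Xz a a0 a1; have := aX x Xx.
  rewrite -zw /inversion enorm_sqr dotZr mulrC ltr_pdivrMr// => h1 h2; lra.
rewrite radial_closure_star//.
- apply/seteqP; split=> [y Wy x Xx|y Xy a a0 a1].
    rewrite leNgt; apply/negP => xy.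
    have xyV : (dot x y)^-1 * dot x y = 1 by rewrite mulVf// gt_eqF//; lra.
    have [||b /andP[_ b1]] := Wy (dot x y)^-1.
    + by rewrite invr_ge0; lra.
    + by rewrite invf_lt1//; lra.
    + by move=> /(_ _ Xx); rewrite dotZr xyV; lra.
  exists ((1 + a) / 2); first by lra.
  by move=> x /Xy xy; rewrite dotZr; nra.
- exists 2^-1; first by lra.
  by move=> x _; rewrite dot0r; lra.
- move=> w a [b b01 bw] a0 a1; exists b => // x /bw xb; rewrite dotZr.
  by have [d0|d0] := leP (dot x w) 0; nra.
Qed.

End Flowers.

(** * Bijections preserving triangles at the origin *)

Section TriangleMaps.
Set Implicit Arguments.
Unset Strict Implicit.
Unset Printing Implicit Defensive.
Variables (R : realType) (n : nat).
Local Notation V := 'rV[R]_n.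
Implicit Types (x y z : V) (K : set V) (T : V -> V) (a b : R).

Definition tri x y : set V := [set z | exists a b : R,
  [/\ 0 <= a, 0 <= b, a + b <= 1 & z = a *: x + b *: y]].

Lemma tri_diagP x z :
  tri x x z <-> exists a : R, [/\ 0 <= a, a <= 1 & z = a *: x].
Proof.
split=> [[a [b [a0 b0 ab ->]]]|[a [a0 a1 ->]]].
  by exists (a + b); rewrite addr_ge0// scalerDl.
by exists a, 0; rewrite addr0 scale0r addr0.
Qed.

Lemma tri_memr x y : tri x y y.
Proof. by exists 0, 1; rewrite ler01 add0r scale0r scale1r add0r. Qed.

Lemma tri_meml x y : tri x y x.
Proof. by exists 1, 0; rewrite ler01 addr0 scale0r scale1r addr0. Qed.

(** Such a point is a point of [[x, y]] contracted towards 0 by [a + b]. *)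
Lemma K0_tri K x y : K0 K -> K x -> K y -> tri x y `<=` K.
Proof.
move=> [_ /convexP cK zK] Kx Ky _ [a [b [a0 b0 ab ->]]].
have [s0|sn0] := eqVneq (a + b) 0.
  have -> : a = 0 by lra.
  have -> : b = 0 by lra.
  by rewrite !scale0r addr0.
have s0 : 0 < a + b by rewrite lt_def sn0 addr_ge0.
have a1 : a / (a + b) <= 1 by rewrite ler_pdivrMr//; lra.
have := cK x y (a / (a + b)) Kx Ky (divr_ge0 a0 (ltW s0)) a1.
move=> /cK - /(_ 0 (a + b) zK (ltW s0) ab).
rewrite scaler0 addr0 scalerDr !scalerA mulrBr mulr1 mulrCA divff// mulr1.
by rewrite addrAC subrr add0r.
Qed.

Lemma tri_compact x y : compact (tri x y).
Proof.
pose f (p : R * R) : V := (p.1 * p.2) *: x + (p.1 * (1 - p.2)) *: y.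
have -> : tri x y = f @` (`[0, 1] `*` `[0, 1]).
  apply/seteqP; split=> [_ [a [b [a0 b0 ab ->]]]|_ [[s t] [/= s01 t01] <-]].
    have [s0|sn0] := eqVneq (a + b) 0.
      exists (0, 0); first by rewrite /= !in_itv/= lexx ler01.
      have -> : a = 0 by lra.
      have -> : b = 0 by lra.
      by rewrite /f /= !mul0r.
    have s0 : 0 < a + b by rewrite lt_def sn0 addr_ge0.
    exists (a + b, a / (a + b)).
      have a1 : a / (a + b) <= 1 by rewrite ler_pdivrMr//; lra.
      by rewrite /= !in_itv/= (ltW s0) ab a1 (divr_ge0 a0 (ltW s0)).
    rewrite /f /= mulrBr mulr1 mulrCA divff// mulr1.
    by congr (_ + _ *: _); ring.
  move: s01 t01; rewrite /= !in_itv/= => /andP[s0 s1] /andP[t0 t1].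
  by exists (s * t), (s * (1 - t)); rewrite /f /=; split=> //; nra.
apply: continuous_compact; last by apply: compact_setX; exact: segment_compact.
apply: continuous_subspaceT => p.
have c1 : (fun q : R * R => q.1) @ p --> p.1 by exact: cvg_fst.
have c2 : (fun q : R * R => q.2) @ p --> p.2 by exact: cvg_snd.
have c3 : (fun q : R * R => 1 - q.2) @ p --> 1 - p.2.
  by apply: cvgB => //; exact: cvg_cst.
by apply: cvgD; apply: cvgZr_tmp; exact: cvgM.
Qed.

Lemma tri_K0 x y : K0 (tri x y).
Proof.
split.
- by apply: compact_closed; [exact: norm_hausdorff | exact: tri_compact].
- apply/convexP => _ _ a [b [c [b0 c0 bc ->]]] [d [e [d0 e0 de ->]]] a0 a1.
  exists (a * b + (1 - a) * d), (a * c + (1 - a) * e); split; [nra|nra|nra|].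
  by apply/rowP => i; rewrite !mxE; ring.
- by exists 0, 0; rewrite !lexx addr0 !scale0r addr0.
Qed.

Definition tri_iso T T' := [/\ cancel T T', cancel T' T,
  forall x y z, tri x y z -> tri (T x) (T y) (T z)
  & forall x y z, tri x y z -> tri (T' x) (T' y) (T' z)].

Lemma tri_isoC T T' : tri_iso T T' -> tri_iso T' T.
Proof. by case. Qed.

(** 0 is on the segment ending at [T' 0], whose image lies in the segment ending at 0. *)
Lemma tri_iso0 T T' : tri_iso T T' -> T 0 = 0.
Proof.
move=> [_ T'K triT _].
have : tri (T (T' 0)) (T (T' 0)) (T 0).
  by apply: triT; apply/tri_diagP; exists 0; rewrite ler01 lexx scale0r.
by rewrite T'K => /tri_diagP[a [_ _ ->]]; rewrite scaler0.
Qed.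

Lemma tri_iso_eq0 T T' x : tri_iso T T' -> T x = 0 -> x = 0.
Proof.
move=> tT Tx; have [TK _ _ _] := tT.
by rewrite -(TK x) Tx (tri_iso0 (tri_isoC tT)).
Qed.

Lemma tri_iso_ray T T' x a : tri_iso T T' -> 0 <= a ->
  exists2 b, 0 <= b & T (a *: x) = b *: T x.
Proof.
move=> tT a0; have [TK T'K triT _] := tT.
have [a1|a1] := leP a 1.
  have /tri_diagP[b [b0 _ Tb]] : tri (T x) (T x) (T (a *: x)).
    by apply: triT; apply/tri_diagP; exists a.
  by exists b.
have an0 : a != 0 by rewrite gt_eqF//; lra.
have /tri_diagP[b [b0 _ Tb]] : tri (T (a *: x)) (T (a *: x)) (T x).
  apply: triT; apply/tri_diagP; exists a^-1; rewrite invr_ge0 a0.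
  by rewrite scalerA mulVf// scale1r; split=> //; rewrite ltW// invf_lt1//; lra.
have [bz|bn0] := eqVneq b 0.
  have x0 : x = 0 by apply: (tri_iso_eq0 tT); rewrite Tb bz scale0r.
  by exists 0 => //; rewrite x0 scaler0 (tri_iso0 tT) scaler0.
by exists b^-1; rewrite ?invr_ge0// Tb scalerA mulVf// scale1r.
Qed.

(** The triangle of [x] and [- x] is a segment through 0, so the preimage of the midpoint [m] is on
    one of the two rays. Hence [m] is a multiple of [T x] or of [T (- x)]. *)
Lemma tri_iso_opp T T' x : tri_iso T T' -> exists b, T (- x) = b *: T x.
Proof.
move=> tT; have [TK T'K triT triT'] := tT.
pose m := 2^-1 *: T x + 2^-1 *: T (- x).
have : tri x (- x) (T' m).
  by rewrite -{1}(TK x) -(TK (- x)); apply: triT'; exists 2^-1, 2^-1; split=> //; lra.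
move=> [a [b [a0 b0 ab]]]; rewrite scalerN -scalerBl => mab.
have [ba|ba] := leP b a.
  have /triT/tri_diagP[t [_ _]] : tri x x (T' m).
    by apply/tri_diagP; exists (a - b); split=> //; lra.
  rewrite T'K => mt; exists (2 * t - 1).
  rewrite scalerBl scale1r -scalerA -mt /m scalerDr !scalerA divff// !scale1r.
  by rewrite addrC addKr.
have /triT/tri_diagP[t [_ _]] : tri (- x) (- x) (T' m).
  apply/tri_diagP; exists (b - a); split; [lra|lra|].
  by rewrite scalerN -scaleNr opprB.
rewrite T'K => mt.
have Tx : T x = (2 * t - 1) *: T (- x).
  by rewrite scalerBl scale1r -scalerA -mt /m scalerDr !scalerA divff// !scale1r addrK.
have [t0|tn0] := eqVneq (2 * t - 1) 0.
  have x0 : x = 0 by apply: (tri_iso_eq0 tT); rewrite Tx t0 scale0r.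
  by exists 0; rewrite x0 oppr0 (tri_iso0 tT) scaler0.
by exists (2 * t - 1)^-1; rewrite Tx scalerA mulVf// scale1r.
Qed.

Lemma tri_iso_line T T' x a : tri_iso T T' -> exists b, T (a *: x) = b *: T x.
Proof.
move=> tT; have [a0|a0] := leP 0 a.
  by have [b _ Tb] := tri_iso_ray x tT a0; exists b.
have [|b _ Tb] := @tri_iso_ray T T' x (- a) tT; first by lra.
have [c Tc] := tri_iso_opp ((- a) *: x) tT.
by exists (c * b); rewrite -scalerA -Tb -Tc scaleNr opprK.
Qed.

(** * Independent pairs and images of segments *)

Definition indep x y := forall a b, a *: x + b *: y = 0 -> a = 0 /\ b = 0.

Lemma indepC x y : indep x y -> indep y x.
Proof. by move=> xy a b; rewrite addrC => /xy[]. Qed.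

Lemma indep_neq x y a : indep x y -> x <> a *: y.
Proof.
move=> xy xa; have [] := xy 1 (- a); first by rewrite scale1r scaleNr xa subrr.
by move=> /eqP; rewrite oner_eq0.
Qed.

Lemma indepP x y : x != 0 -> (forall a, y <> a *: x) -> indep x y.
Proof.
move=> x0 xy a b ab; have [b0|bn0] := eqVneq b 0.
  move: ab; rewrite b0 scale0r addr0 => /eqP.
  by rewrite scaler_eq0 (negPf x0) orbF => /eqP.
case: (xy (- a / b)); rewrite mulrC -scalerA scaleNr.
by move/eqP: ab; rewrite addrC addr_eq0 => /eqP <-; rewrite scalerA mulVf ?scale1r.
Qed.

Lemma indepZ x y a b : indep x y -> a != 0 -> b != 0 -> indep (a *: x) (b *: y).
Proof.
move=> xy a0 b0 c d; rewrite !scalerA => /xy[/eqP + /eqP].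
by rewrite !mulf_eq0 (negPf a0) (negPf b0) !orbF => /eqP-> /eqP->.
Qed.

Lemma indepDl x y a b : indep x y -> a != 0 -> indep (a *: x + b *: y) y.
Proof.
move=> xy a0 c d; rewrite scalerDr !scalerA -addrA -scalerDl => /xy[/eqP].
rewrite mulf_eq0 (negPf a0) orbF => /eqP->.
by rewrite mul0r add0r.
Qed.

Lemma tri_iso_indep T T' x y : tri_iso T T' -> indep x y -> indep (T x) (T y).
Proof.
move=> tT xy; have [TK T'K _ _] := tT; apply: indepP => [|a Ty].
  apply/eqP => Tx; apply: (@indep_neq _ _ 0 xy).
  by rewrite scale0r; apply: (tri_iso_eq0 tT).
have [b] := tri_iso_line (T x) a (tri_isoC tT); rewrite -Ty !TK.
exact: indep_neq (indepC xy).
Qed.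

(** [[x, y]] consists of the points of the triangle that cannot be stretched away from 0 within it,
    a property [T] preserves. *)
Lemma tri_iso_segment T T' x y t : tri_iso T T' -> indep x y ->
  0 <= t -> t <= 1 ->
  exists s : R, [/\ 0 <= s, s <= 1 &
    T ((1 - t) *: x + t *: y) = (1 - s) *: T x + s *: T y].
Proof.
move=> tT xy t0 t1; have [TK T'K triT triT'] := tT.
set z := _ + _; have zn0 : z <> 0 by move=> /xy[]; lra.
have [|a [b [a0 b0 ab Tz]]] := triT x y z; first by exists (1 - t), t; split=> //; lra.
have s0 : 0 < a + b.
  rewrite lt_def addr_ge0// andbT; apply/eqP => ab0; apply: zn0.
  apply: (tri_iso_eq0 tT); rewrite Tz.
  have -> : a = 0 by lra.
  have -> : b = 0 by lra.
  by rewrite !scale0r addr0.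
suff ab1 : a + b = 1 by exists b; split; [lra|lra|rewrite -ab1 addrK].
(* Stretches [T z] to the far side of the image triangle. *)
pose w := (a + b)^-1 *: T z.
have [c [d [c0 d0 cd T'w]]] : tri x y (T' w).
  rewrite -{1}(TK x) -{1}(TK y); apply: triT'.
  exists (a / (a + b)), (b / (a + b)); split.
  - exact: divr_ge0 a0 (ltW s0).
  - exact: divr_ge0 b0 (ltW s0).
  - by rewrite -mulrDl divff// gt_eqF.
  - by rewrite /w Tz scalerDr !scalerA !(mulrC (a + b)^-1).
have : tri (T' w) (T' w) z.
  rewrite -(TK z); apply: triT'; apply/tri_diagP.
  by exists (a + b); rewrite ltW// ab /w scalerA divff ?scale1r// gt_eqF.
move=> /tri_diagP[r [r0 r1]] zr.
have [e1 e2] : 1 - t - r * c = 0 /\ t - r * d = 0.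
  apply: xy; rewrite scalerBl (scalerBl t) addrACA -/z zr T'w scalerDr !scalerA -opprD.
  by rewrite subrr.
(* The coordinates of [z] sum to 1, so [r * (c + d) = 1] with both factors at most 1. *)
have r_1 : r = 1 by nra.
have : T z = w by rewrite zr r_1 scale1r T'K.
rewrite /w => Tzw; have : (1 - (a + b)^-1) *: T z = 0.
  by rewrite scalerBl scale1r {1}Tzw subrr.
move=> /eqP; rewrite scaler_eq0 => /orP[|/eqP /(tri_iso_eq0 tT)//].
by rewrite subr_eq0 eq_sym => /eqP/(congr1 GRing.inv); rewrite invrK invr1.
Qed.

(* The reason is that [T] maps the parallels [x + R y] and [R y] to disjoint
   coplanar lines. *)
Lemma tri_iso_parallel T T' x y : tri_iso T T' -> indep x y ->
  exists b, T (x + y) = T x + b *: T y.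
Proof.
move=> tT xy; have [TK T'K triT triT'] := tT; have tT' := tri_isoC tT.
have Txy := tri_iso_indep tT xy.
have [a [b [a0 Tab]]] : exists a b, 0 <= a /\ T (x + y) = a *: T x + b *: T y.
  have [||s [_ s1 Ts]] := @tri_iso_segment T T' x y 2^-1 tT xy; [lra|lra|].
  have -> : x + y = 2 *: ((1 - 2^-1) *: x + 2^-1 *: y).
    apply/rowP => i; rewrite !mxE; lra.
  have [c c0 ->] := @tri_iso_ray T T' ((1 - 2^-1) *: x + 2^-1 *: y) 2 tT (ler0n _ _).
  exists (c * (1 - s)), (c * s); rewrite Ts scalerDr !scalerA; split=> //.
  by rewrite mulr_ge0// subr_ge0.
have [a1|an1] := eqVneq a 1; first by exists b; rewrite Tab a1 scale1r.
exfalso.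
have bn0 : b != 0.
  apply/eqP => b0; have [c] := tri_iso_line (T x) a tT'.
  move: Tab; rewrite b0 scale0r addr0 => <-; rewrite !TK => xyc.
  have [] := xy (1 - c) 1; last by move=> _ /eqP; rewrite oner_eq0.
  by rewrite scalerBl !scale1r addrAC -xyc subrr.
have s1 : 1 - a != 0 by rewrite subr_eq0 eq_sym.
(* Where the line through [T x] and [T (x + y)] meets the line of [T y]. *)
pose w := (b / (1 - a)) *: T y.
have wn0 : b / (1 - a) != 0 by rewrite mulf_neq0// invr_neq0.
have [c T'w] : exists c, T' w = c *: y.
  by have := tri_iso_line (T y) (b / (1 - a)) tT'; rewrite TK.
(* Either [T (x + y)] is between [T x] and [w], or [T x] is between [T (x + y)] and [w]. Pulled
   back, a segment from [x] to the line of [y] would contain [x + y], or one from [x + y] would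
   contain [x]. *)
have [a_lt1|a_ge1] := ltP a 1.
  have iw : indep (T x) w by rewrite -[T x]scale1r; apply: indepZ; rewrite ?oner_eq0.
  have [||r [r0 r1]] := @tri_iso_segment T' T (T x) w (1 - a) tT' iw; [lra|lra|].
  have -> : (1 - (1 - a)) *: T x + (1 - a) *: w = T (x + y).
    by rewrite Tab /w scalerA mulrCA divff// mulr1; congr (_ *: _ + _); ring.
  rewrite !TK T'w scalerA => xyr.
  have [|r10 rc] := xy r (1 - r * c); last by move: rc; rewrite r10 mul0r subr0; lra.
  by apply/rowP => i; move/rowP: xyr => /(_ i); rewrite !mxE; lra.
have an0 : a != 0 by rewrite gt_eqF//; lra.
have iw : indep (T (x + y)) w.
  by rewrite Tab -[_ + _]scale1r; apply: indepZ; rewrite ?oner_eq0//; apply: indepDl.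
have ai0 : 0 <= a^-1 by rewrite invr_ge0.
have ai1 : a^-1 <= 1 by rewrite invf_le1//; lra.
have [||r [r0 r1]] := @tri_iso_segment T' T _ w (1 - a^-1) tT' iw; [lra|lra|].
have -> : (1 - (1 - a^-1)) *: T (x + y) + (1 - a^-1) *: w = T x.
  have -> : 1 - (1 - a^-1) = a^-1 by ring.
  rewrite Tab /w scalerDr !scalerA mulVf// scale1r -addrA -scalerDl.
  rewrite [X in _ + X *: _](_ : _ = 0) ?scale0r ?addr0//.
  by field; rewrite s1 an0.
rewrite !TK T'w scalerA => xyr.
have [|r10 rc] := xy r (- (1 - r + r * c)); last by move: rc; rewrite r10; lra.
by apply/rowP => i; move/rowP: xyr => /(_ i); rewrite !mxE; lra.
Qed.

(** [tri_iso_parallel] for both orders of the pair expands one vector twice in the independent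
    [T x], [T y]. *)
Lemma tri_iso_add_indep T T' x y : tri_iso T T' -> indep x y ->
  T (x + y) = T x + T y.
Proof.
move=> tT xy; have [b Tb] := tri_iso_parallel tT xy.
have [a] := tri_iso_parallel tT (indepC xy); rewrite addrC Tb => Ta.
have iT := tri_iso_indep tT xy; have [|_ b1] := iT (1 - a) (b - 1).
  by apply/rowP => i; move/rowP: Ta => /(_ i); rewrite !mxE; lra.
have b1E : b = 1 by lra.
by rewrite b1E scale1r.
Qed.

Lemma exists_indep x : (2 <= n)%N -> x != 0 -> exists y, indep x y.
Proof.
move=> n2 x0; have [i xi] : exists i, x ord0 i != 0.
  apply: contrapT => h; case/eqP: x0; apply/rowP => i; rewrite mxE.
  by apply: contrapT => xi; apply: h; exists i; apply/eqP.
have [j ij] : exists j : 'I_n, j != i.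
  apply: contrapT => h; move: n2; rewrite -[n]card_ord.
  suff : (#|'I_n| <= 1)%N by rewrite ltnNge => ->.
  apply/card_le1_eqP => j k _ _.
  suff e l : l = i by rewrite (e j) (e k).
  by apply/eqP; apply: contrapT => /negP li; apply: h; exists l.
exists (delta_mx ord0 j); apply: indepC; apply: indepP => [|a].
  apply/eqP => /rowP/(_ j); rewrite !mxE !eqxx => /eqP; by rewrite oner_eq0.
move=> /rowP/(_ i); rewrite !mxE eqxx [i == j]eq_sym (negPf ij) mulr0.
by apply/eqP.
Qed.

(** For [y] on the line of [x], a vector [z] off that line reduces to independent pairs:
    [T (x + y + z)] is expanded in two ways. *)
Lemma tri_iso_add T T' x y : (2 <= n)%N -> tri_iso T T' ->
  T (x + y) = T x + T y.
Proof.
move=> n2 tT; have T0 := tri_iso0 tT.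
have [->|x0] := eqVneq x 0; first by rewrite T0 !add0r.
have [[a ->]|nxy] := pselect (exists a, y = a *: x); last first.
  by apply: (tri_iso_add_indep tT); apply: indepP => // a ya; apply: nxy; exists a.
have [z xz] := exists_indep n2 x0.
have Tz b : T (b *: x + z) = T (b *: x) + T z.
  have [->|b0] := eqVneq b 0; first by rewrite scale0r T0 !add0r.
  by apply: (tri_iso_add_indep tT); rewrite -[z]scale1r; apply: indepZ; rewrite ?oner_eq0.
apply: (addIr (T z)).
have -> : x + a *: x = (1 + a) *: x by rewrite scalerDl scale1r.
rewrite -Tz scalerDl scale1r.
rewrite -!addrA -Tz; apply: (tri_iso_add_indep tT).
have := @indepDl z x 1 a (indepC xz) (oner_neq0 R); rewrite scale1r addrC.
exact: indepC.
Qed.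

(** If the multiplier [b] differed from [a], a rational [m / k] strictly between them would give a
    nonnegative multiple of [x] whose image is a negative multiple of [T x]. *)
Lemma tri_iso_scale T T' a x : (2 <= n)%N -> tri_iso T T' ->
  T (a *: x) = a *: T x.
Proof.
move=> n2 tT; have T0 := tri_iso0 tT.
have [->|x0] := eqVneq x 0; first by rewrite T0 !scaler0.
have Tx0 : T x != 0 by apply: contraNneq x0 => /(tri_iso_eq0 tT) ->.
have TD y z : T (y + z) = T y + T z := tri_iso_add y z n2 tT.
have TN y : T (- y) = - T y.
  by apply/eqP; rewrite -addr_eq0 -TD addNr T0.
have TMn y k : T (k%:R *: y) = k%:R *: T y.
  elim: k => [|k IH]; first by rewrite !scale0r T0.
  by rewrite -natr1 !scalerDl !scale1r TD IH.
have TMz y (m : int) : T (m%:~R *: y) = m%:~R *: T y.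
  by case: m => m; rewrite ?NegzE ?mulrNz ?scaleNr ?TN -?pmulrn TMn.
have pos (c d : R) : 0 <= c -> T (c *: x) = d *: T x -> 0 <= d.
  move=> c0; have [e e0 ->] := tri_iso_ray x tT c0 => /eqP.
  by rewrite -subr_eq0 -scalerBl scaler_eq0 (negPf Tx0) orbF subr_eq0 => /eqP <-.
have [b Tb] := tri_iso_line x a tT; rewrite Tb; congr (_ *: _).
have Tkm (k m : int) :
    T ((k%:~R * a - m%:~R) *: x) = (k%:~R * b - m%:~R) *: T x.
  by rewrite !scalerBl TD TN -!scalerA !TMz Tb.
have key (u v : R) : u < v -> exists k m : int, k%:~R * u < m%:~R < k%:~R * v.
  (* [k] exceeds the inverse of the gap, so an integer fits strictly between [k u] and [k v]. *)
  move=> uv; pose k := Num.floor (v - u)^-1 + 1; exists k, (Num.floor (k%:~R * u) + 1).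
  have kuv : (v - u)^-1 < k%:~R := floorD1_gt _.
  have := floor_le (k%:~R * u); have := floorD1_gt (k%:~R * u).
  rewrite -[(v - u)^-1]mul1r ltr_pdivrMr ?subr_gt0// in kuv.
  rewrite intrD; lra.
have [ba|ab|//] := ltrgtP b a.
  have [k [m /andP[h1 h2]]] := key _ _ ba.
  have h : 0 <= k%:~R * a - m%:~R by lra.
  by have := pos _ _ h (Tkm k m); lra.
have [k [m /andP[h1 h2]]] := key _ _ ab.
have h : 0 <= (- k)%:~R * a - (- m)%:~R by rewrite !mulrNz; lra.
by have := pos _ _ h (Tkm (- k) (- m)); rewrite !mulrNz; lra.
Qed.

Lemma tri_iso_mulmx T T' : (2 <= n)%N -> tri_iso T T' ->
  exists M : 'M[R]_n, forall x, T x = x *m M.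
Proof.
move=> n2 tT.
have linT : linear T.
  by move=> a x y; rewrite (tri_iso_add _ _ n2 tT) (tri_iso_scale _ _ n2 tT).
pose LT : {linear V -> V} := HB.pack T (GRing.isLinear.Build R V V *:%R T linT).
by exists (lin1_mx LT) => x; rewrite mul_rV_lin1.
Qed.

Lemma tri_iso_unitmx T T' : (2 <= n)%N -> tri_iso T T' ->
  exists2 M : 'M[R]_n, M \in unitmx & forall x, T x = x *m M.
Proof.
move=> n2 tT; have [TK _ _ _] := tT.
have [M TM] := tri_iso_mulmx n2 tT.
have [M' TM'] := tri_iso_mulmx n2 (tri_isoC tT).
exists M => //; apply: (proj1 (@mulmx1_unit _ _ M M' _)).
by apply/row_matrixP => i; rewrite !rowE mulmxA -TM -TM' TK mulmx1.
Qed.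

End TriangleMaps.

(** * Order isomorphisms of convex sets and flowers *)

Section OrderIsomorphisms.
Set Implicit Arguments.
Unset Strict Implicit.
Unset Printing Implicit Defensive.
Variables (R : realType) (n : nat).
Hypothesis n2 : (2 <= n)%N.
Local Notation V := 'rV[R]_n.
Implicit Types (x y z : V) (F K L : set V) (h : set V -> set V).

Let n0 : (0 < n)%N. Proof. exact: ltnW. Qed.

Lemma tri_scale y (s t : R) : 0 <= s -> s <= t -> tri (t *: y) (t *: y) (s *: y).
Proof.
move=> s0 st; apply/tri_diagP; have [t0|tn0] := eqVneq t 0.
  by exists 0; rewrite lexx ler01 scale0r; split=> //; rewrite (_ : s = 0) ?scale0r//; lra.
have tp : 0 < t by rewrite lt_def tn0; lra.
exists (s / t); rewrite (divr_ge0 s0 (ltW tp)) scalerA divfK//; split=> //.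
by rewrite ler_pdivrMr// mul1r.
Qed.

Lemma tri_diag_inj x y : tri x x = tri y y -> x = y.
Proof.
move=> xy; have /tri_diagP[a [a0 a1 xa]] : tri y y x by rewrite -xy; exact: tri_memr.
have /tri_diagP[b [b0 b1 yb]] : tri x x y by rewrite xy; exact: tri_memr.
have [y0|yn0] := eqVneq y 0; first by rewrite xa y0 scaler0.
have : (1 - b * a) *: y = 0 by rewrite scalerBl scale1r -scalerA -xa -yb subrr.
move/eqP; rewrite scaler_eq0 (negPf yn0) orbF => /eqP ba.
have a_1 : a = 1 by nra.
by rewrite xa a_1 scale1r.
Qed.

(* An order-theoretic characterization of the segments [[0, x]] in [K0]: the
   sets below which [K0] is a chain are the segments and the rays from 0, and
   only the rays are maximal among them. *)
Definition nonmaximal_chain K := K0 K /\ exists L,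
  [/\ K0 L, K `<=` L, ~ (L `<=` K) & forall A B, K0 A -> K0 B ->
      A `<=` L -> B `<=` L -> A `<=` B \/ B `<=` A].

Lemma tri_diag_chain y A B : K0 A -> K0 B -> A `<=` tri y y -> B `<=` tri y y ->
  A `<=` B \/ B `<=` A.
Proof.
move=> KA KB Ay By; have [|/existsNP[x /not_implyP[Ax nBx]]] := pselect (A `<=` B).
  by left.
right=> b Bb; have /tri_diagP[s [s0 _ xs]] := Ay _ Ax.
have /tri_diagP[t [t0 _ bt]] := By _ Bb.
have [st|ts] := leP s t.
  by case: nBx; apply: (K0_tri KB Bb Bb); rewrite xs bt; exact: tri_scale.
by apply: (K0_tri KA Ax Ax); rewrite xs bt; apply: tri_scale => //; exact: ltW.
Qed.

Lemma nonmaximal_chain_tri x : nonmaximal_chain (tri x x).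
Proof.
split; first exact: tri_K0.
have [y yx nyx] : exists2 y, tri y y x & ~ tri x x y.
  have [->|x0] := eqVneq x 0.
    have [u u1] := exists_unit R n0; exists u.
      by apply/tri_diagP; exists 0; rewrite lexx ler01 scale0r.
    move=> /tri_diagP[a [_ _]]; rewrite scaler0 => u0.
    by move: u1; rewrite u0 enormE dot0l sqrtr0 => /eqP; rewrite eq_sym oner_eq0.
  exists (2 *: x).
    by have := @tri_scale x 1 2 ler01; rewrite scale1r ler1n; exact.
  move=> /tri_diagP[a [a0 a1 xa]].
  have : (2 - a) *: x = 0 by rewrite scalerBl xa subrr.
  by move/eqP; rewrite scaler_eq0 (negPf x0) orbF => /eqP; lra.
exists (tri y y); split; first exact: tri_K0.
- by apply: K0_tri => //; exact: tri_K0.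
- by move=> /(_ _ (tri_memr y y)).
- by move=> A B; exact: tri_diag_chain.
Qed.

(** For [y] in [L] outside [K], comparing [[0, k]] with [[0, y]] puts each [k] of [K] in [[0, y]].
    So [K] is compact, and its point farthest along [y] is the endpoint. *)
Lemma nonmaximal_chainP K : nonmaximal_chain K -> exists x, K = tri x x.
Proof.
move=> [KK [L [KL KsL /existsNP[y /not_implyP[Ly nKy]] chain]]].
have Ky : K `<=` tri y y.
  move=> k Kk; have Lk := KsL _ Kk.
  have [||s|s] := chain (tri k k) (tri y y) (tri_K0 k k) (tri_K0 y y).
  - exact: K0_tri.
  - exact: K0_tri.
  - exact: s (tri_memr k k).
  - case: nKy; exact: (K0_tri KK Kk (y := k) Kk (s _ (tri_memr y y))).
have [cK _ zK] := KK.
have yy : 0 < dot y y by apply: dot_gt0; apply/eqP => y0; apply: nKy; rewrite y0.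
have cmK : compact K := subclosed_compact cK (@tri_compact R n y y) Ky.
have cfK : {within K, continuous (dot y : V -> R)}.
  by apply: continuous_subspaceT; exact: dot_continuous.
have [|z /set_mem Kz zmax] := compact_EVT_max _ cmK cfK; first by exists 0.
exists z; apply/seteqP; split; last exact: K0_tri.
move=> k Kk; have /tri_diagP[s [s0 _ ks]] := Ky _ Kk.
have /tri_diagP[t [t0 _ zt]] := Ky _ Kz.
have := zmax k (mem_set Kk); rewrite ks zt !dotZr ler_pM2r//.
exact: tri_scale.
Qed.

(** Half of an order isomorphism; the other half is [K0_iso h' h]. *)
Definition K0_iso h h' := (forall K, K0 K -> K0 (h K) /\ h' (h K) = K) /\
  (forall K L, K0 K -> K0 L -> K `<=` L -> h K `<=` h L).

Lemma nonmaximal_chain_iso h h' K : K0_iso h h' -> K0_iso h' h ->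
  nonmaximal_chain K -> nonmaximal_chain (h K).
Proof.
move=> [hK hS] [h'K h'S] [KK [L [KL KsL nLK chain]]].
have [KhK hKK] := hK _ KK; have [KhL hLL] := hK _ KL.
split=> //; exists (h L); split=> //.
- exact: hS.
- by move=> /(h'S _ _ KhL KhK); rewrite hKK hLL.
move=> A B KA KB AL BL; have [KhA hAA] := h'K _ KA; have [KhB hBB] := h'K _ KB.
have [||s|s] := chain (h' A) (h' B) KhA KhB.
- by rewrite -hLL; exact: h'S.
- by rewrite -hLL; exact: h'S.
- by left; rewrite -hAA -hBB; exact: hS.
- by right; rewrite -hAA -hBB; exact: hS.
Qed.

Lemma K0_iso_point h h' : K0_iso h h' -> K0_iso h' h ->
  exists T : V -> V, forall x, h (tri x x) = tri (T x) (T x).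
Proof.
move=> hh hh'; have /choice[T hT] : forall x, exists z, h (tri x x) = tri z z.
  move=> x; apply: nonmaximal_chainP; apply: nonmaximal_chain_iso hh hh' _.
  exact: nonmaximal_chain_tri.
by exists T.
Qed.

Lemma K0_iso_cancel h h' (T T' : V -> V) : K0_iso h h' ->
  (forall x, h (tri x x) = tri (T x) (T x)) ->
  (forall x, h' (tri x x) = tri (T' x) (T' x)) -> cancel T T'.
Proof.
move=> [hK _] hT hT' x; apply: tri_diag_inj.
by rewrite -hT' -hT; have [] := hK _ (tri_K0 x x).
Qed.

Lemma K0_iso_mem h h' (T : V -> V) K x : K0_iso h h' ->
  (forall x, h (tri x x) = tri (T x) (T x)) -> K0 K -> K x -> h K (T x).
Proof.
move=> [_ hS] hT KK Kx; have := hS _ _ (tri_K0 x x) KK (K0_tri KK Kx Kx).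
by rewrite hT; apply; exact: tri_memr.
Qed.

(** The preimage of the triangle of [T x], [T y] is in [K0] and contains [x] and [y], hence their
    triangle. *)
Lemma K0_iso_tri h h' (T T' : V -> V) : K0_iso h h' -> K0_iso h' h ->
  (forall x, h (tri x x) = tri (T x) (T x)) ->
  (forall x, h' (tri x x) = tri (T' x) (T' x)) ->
  forall x y z, tri x y z -> tri (T x) (T y) (T z).
Proof.
move=> hh hh' hT hT' x y z xyz; have TK := K0_iso_cancel hh hT hT'.
have [KL LK] := hh'.1 _ (tri_K0 (T x) (T y)).
rewrite -LK; apply: (K0_iso_mem hh hT) => //; apply: (K0_tri KL _ _ xyz).
  by have := K0_iso_mem hh' hT' (tri_K0 _ _) (@tri_meml R n (T x) (T y)); rewrite TK.
by have := K0_iso_mem hh' hT' (tri_K0 _ _) (@tri_memr R n (T x) (T y)); rewrite TK.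
Qed.

Lemma K0_iso_linear h h' : K0_iso h h' -> K0_iso h' h ->
  exists2 M : 'M[R]_n, M \in unitmx &
    forall K, K0 K -> h K = (fun x => x *m M) @` K.
Proof.
move=> hh hh'; have [T hT] := K0_iso_point hh hh'.
have [T' hT'] := K0_iso_point hh' hh.
have TK := K0_iso_cancel hh hT hT'; have T'K := K0_iso_cancel hh' hT' hT.
have tT : tri_iso T T'.
  by split=> //; [exact: (K0_iso_tri hh hh') | exact: (K0_iso_tri hh' hh)].
have [M uM TM] := tri_iso_unitmx n2 tT; exists M => // K KK.
have [KhK hKK] := hh.1 _ KK.
apply/seteqP; split=> [y hy|_ [x Kx <-]].
  exists (T' y); last by rewrite -TM T'K.
  by rewrite -hKK; exact: (K0_iso_mem hh' hT').
by rewrite -TM; exact: (K0_iso_mem hh hT).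
Qed.

(** * Transfer from [K0] to flowers *)

Lemma core_K0 F : flower F -> K0 (core F).
Proof. by move=> /(flowerP _ n0)[X X0 ->]; rewrite core_pedal//; exact: polar_K0. Qed.

Lemma flower_pedal K : K0 K -> flower (pedal K).
Proof. by move=> [_ _ K0]; apply/(flowerP _ n0); exists K => //; exists 0. Qed.

Lemma core_pedal_K0 K : K0 K -> core (pedal K) = K.
Proof.
move=> KK; rewrite core_pedal; first exact: bipolar.
by have [_ _ ?] := KK; exists 0.
Qed.

(** Both flowers have the same core, so [pedalS] applies in both directions. *)
Lemma pedal_core F : flower F -> pedal (core F) = F.
Proof.
move=> fF; have KF := core_K0 fF; have cc := core_pedal_K0 KF.
have [_ _ zF] := KF; have cF0 : core F !=set0 by exists 0.
move: fF => /(flowerP _ n0)[X X0 FX].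
by apply/seteqP; split; [rewrite {2}FX|rewrite {1}FX]; apply: pedalS;
  rewrite // -FX cc.
Qed.

Lemma co_image_core F : flower F -> co_image F = polar (core F).
Proof.
move=> /(flowerP _ n0)[X X0 ->]; rewrite co_image_pedal// core_pedal//.
by rewrite bipolar//; exact: polar_K0.
Qed.

Lemma flower_iso_linear f : set_bij flower K0 f ->
  (forall F1 F2 : set V, flower F1 -> flower F2 ->
    (F1 `<=` F2 <-> f F1 `<=` f F2)) ->
  exists2 M : 'M[R]_n, M \in unitmx &
    forall F, flower F -> f F = (fun x => x *m M) @` core F.
Proof.
move=> [fK finj fsurj] fS.
have /choice[f' f'P] L : exists F, K0 L -> flower F /\ f F = L.
  have [/fsurj[F fF <-]|nL] := pselect (K0 L); first by exists F.
  by exists set0 => /nL.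
have f'f F : flower F -> f' (f F) = F.
  move=> fF; have [ff' fe] := f'P _ (fK _ fF).
  by apply: finj => //; exact/mem_set.
(* The inverse bijections [core] and [pedal] turn [f] into a self-map of [K0]. *)
pose h K := f (pedal K); pose h' L := core (f' L).
have hh : K0_iso h h'.
  split=> [K KK|K L KK KL KsL].
    have fl := flower_pedal KK; split; first exact: fK.
    by rewrite /h' /h f'f// core_pedal_K0.
  apply/(fS _ _ (flower_pedal KK) (flower_pedal KL)).
  apply: pedalS; first by have [_ _ ?] := KK; exists 0.
  by rewrite !core_pedal_K0.
have hh' : K0_iso h' h.
  split=> [L KL|K L KK KL KsL].
    have [fl fe] := f'P _ KL; split; first exact: core_K0.
    by rewrite /h /h' pedal_core.
  have [flK feK] := f'P _ KK; have [flL feL] := f'P _ KL.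
  have KL' : f' K `<=` f' L by apply/(fS _ _ flK flL); rewrite feK feL.
  by move=> x xK; exact: subset_trans xK KL'.
have [M uM hM] := K0_iso_linear hh hh'; exists M => // F fF.
by rewrite -(hM _ (core_K0 fF)) /h pedal_core.
Qed.

End OrderIsomorphisms.

Lemma mulmxr_bijective (R : comUnitRingType) (m n : nat) (M : 'M[R]_n) :
  M \in unitmx -> bijective (@mulmxr R m n n M).
Proof.
by move=> uM; exists (mulmxr (invmx M)) => x /=; rewrite ?mulmxK ?mulmxKV.
Qed.

Theorem proposition1p3 (R : realType) (n : nat) (hn : (2 <= n)%N) :
  (forall f : set 'rV[R]_n -> set 'rV[R]_n,
    set_bij flower K0 f ->
    (forall F1 F2 : set 'rV[R]_n, flower F1 -> flower F2 ->
      (F1 `<=` F2 <-> f F1 `<=` f F2)) ->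
    exists u : {linear 'rV[R]_n -> 'rV[R]_n},
      bijective u /\
      forall F : set 'rV[R]_n, flower F -> f F = u @` core F)
  /\
  (forall g : set 'rV[R]_n -> set 'rV[R]_n,
    set_bij flower K0 g ->
    (forall F1 F2 : set 'rV[R]_n, flower F1 -> flower F2 ->
      (F1 `<=` F2 <-> g F2 `<=` g F1)) ->
    exists u : {linear 'rV[R]_n -> 'rV[R]_n},
      bijective u /\
      forall F : set 'rV[R]_n, flower F -> g F = u @` co_image F).
Proof.
split=> [f fbij fS|g gbij gS].
  have [M uM fM] := flower_iso_linear hn fbij fS.
  by exists (mulmxr M); split; [exact: mulmxr_bijective | exact: fM].
have [gK ginj gsurj] := gbij.
have pgbij : set_bij flower K0 (fun F => polar (g F)).
  split=> [F _|F1 F2 /set_mem F1f /set_mem F2f pg|L KL].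
  - exact: polar_K0.
  - apply: ginj; [exact/mem_set..|].
    by rewrite -(bipolar (gK _ F1f)) pg bipolar//; exact: gK.
  - have [F fF gF] := gsurj _ (polar_K0 L).
    by exists F => //; rewrite gF bipolar.
have [|M uM gM] := flower_iso_linear hn pgbij.
  move=> F1 F2 f1 f2; split=> [/(gS _ _ f1 f2)|]; first exact: polarS.
  move=> /polarS; rewrite !bipolar; [|exact: gK..].
  by move=> /(gS _ _ f1 f2).
(* [polar (g F)] is the image of [core F] under [M]; taking polars again yields the inverse
   transpose. *)
have uMt : invmx M^T \in unitmx by rewrite unitmx_inv unitmx_tr.
exists (mulmxr (invmx M^T)); split; first exact: mulmxr_bijective.
move=> F fF; rewrite co_image_core//.
by rewrite -(bipolar (gK _ fF)) gM// polar_mulmx.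
Qed.
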